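(* For every positive integer $\ell$ and $|q|<1$, $$\frac{1}{(q;q)_\infty}\sum_{j=-\ell}^{\ell-1}(-1)^jq^{j(3j+1)/2}=1+(-1)^{\ell-1}\sum_{n=0}^\infty\frac{q^{(2\ell+1)n+n^2+\frac32\ell^2+\frac12\ell}(1-q^\ell)}{(q;q)_n(q;q)_{n+2\ell}(1-q^{n+\ell})}.$$
   Context: $(a;q)_n=\prod_{m=0}^{n-1}(1-aq^m)$ with $(a;q)_0=1$, and $(a;q)_\infty=\prod_{m\ge0}(1-aq^m)$. *)

(* Defs.v *)
From Stdlib Require Import Reals ZArith Lia.
From Coquelicot Require Import Coquelicot.

Open Scope C_scope.

Definition Clim (u : nat -> C) : C :=
  @iota C_CompleteNormedModule
    (fun z : C => filterlim u eventually (locally z)).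

Definition ex_Clim (u : nat -> C) : Prop :=
  exists z : C, filterlim u eventually (locally z).

(* Coquelicot's [Series] is for real series only. *)
Definition CSeries (a : nat -> C) : C :=
  @iota C_CompleteNormedModule (fun z : C => is_series a z).

Lemma Clim_unique (u : nat -> C) (z : C) :
  filterlim u eventually (locally z) -> Clim u = z.
Proof.
  intros Hz.
  assert (U : forall w : C, filterlim u eventually (locally w) -> z = w).
  { intros w Hw.
    exact (@filterlim_locally_unique nat C_AbsRing C_NormedModule
             eventually _ u z w Hz Hw). }
  symmetry. apply U.
  exact (@iota_correct C_AbsRing C_CompleteNormedModule
           (fun w : C => filterlim u eventually (locally w))
           (ex_intro _ z (conj Hz U))).
Qed.

Lemma CSeries_unique (a : nat -> C) (z : C) : is_series a z -> CSeries a = z.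
Proof. exact (Clim_unique (sum_n a) z). Qed.

Fixpoint qpoch (a q : C) (n : nat) : C :=
  match n with
  | O => 1
  | S m => qpoch a q m * (1 - a * q ^ m)
  end.

Definition ex_qpoch_inf (a q : C) : Prop := ex_Clim (qpoch a q).

Definition qpoch_inf (a q : C) : C := Clim (qpoch a q).

(* The sum of [f j] over integers [a <= j <= b], zero if [b < a]; the index
   is [j = a - 1 + k] with [1 <= k <= b - a + 1]. *)
Definition Zsum (a b : Z) (f : Z -> C) : C :=
  sum_n_m (fun k : nat => f (a - 1 + Z.of_nat k)%Z) 1 (Z.to_nat (b - a + 1)).

(* Since 1 / (-1) = -1, the integer power of -1 only depends on [|j|]. *)
Definition Zsign (j : Z) : C := (- (1)) ^ Z.abs_nat j.

(* [j (3 j + 1) / 2] is a natural number for every integer [j]: the division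
   and the truncation are exact, see [Zpent_exact]. *)
Definition Zpent (j : Z) : nat := Z.to_nat (j * (3 * j + 1) / 2).

Lemma Zpent_exact (j : Z) : (2 * Z.of_nat (Zpent j) = j * (3 * j + 1))%Z.
Proof.
  unfold Zpent.
  assert (H : exists m, (j * (3 * j + 1) = m * 2)%Z).
  { destruct (Z.Even_or_Odd j) as [[k ->]|[k ->]].
    - exists (k * (3 * (2 * k) + 1))%Z. ring.
    - exists ((2 * k + 1) * (3 * k + 2))%Z. ring. }
  destruct H as [m Hm].
  rewrite Hm, Z.div_mul by lia. nia.
Qed.

(* The exponent [(2 l + 1) n + n^2 + (3/2) l^2 + (1/2) l]; the division is
   exact, see [series_exp_exact]. *)
Definition series_exp (l n : nat) : nat :=
  (2 * l + 1) * n + n ^ 2 + (3 * l ^ 2 + l) / 2.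

Lemma series_exp_exact (l n : nat) :
  (2 * series_exp l n
   = 2 * ((2 * l + 1) * n) + 2 * n ^ 2 + 3 * l ^ 2 + l)%nat.
Proof.
  unfold series_exp.
  assert (H : exists m, (3 * l ^ 2 + l = m * 2)%nat).
  { destruct (Nat.Even_or_Odd l) as [[k ->]|[k ->]].
    - exists (k * (3 * (2 * k) + 1))%nat. simpl. ring.
    - exists ((2 * k + 1) * (3 * k + 2))%nat. simpl. ring. }
  destruct H as [m Hm].
  rewrite Hm, Nat.div_mul by lia. lia.
Qed.

Definition series_term (l : nat) (q : C) (n : nat) : C :=
  q ^ series_exp l n * (1 - q ^ l)
  / (qpoch q q n * qpoch q q (n + 2 * l) * (1 - q ^ (n + l))).

(* Main.v *)
Require Import Defs.
From Stdlib Require Import Reals ZArith Lra Lia.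
From Coquelicot Require Import Coquelicot.
Open Scope C_scope.

(** Write [(q)_n] for [qpoch q q n], [L] for its limit, [T_l] for the truncated
    pentagonal sum and [S_l] for the series on the right.  Going from [l] to
    [l + 1] adds [(-1)^l q^(l(3l+1)/2) (1 - q^(2l+1))] to [T_l], so the identity
    [T_l / L = 1 + (-1)^(l-1) S_l] follows by induction on [l] from

      [S_l + S_(l+1) = q^(l(3l+1)/2) (1 - q^(2l+1)) / L].

    The factor [1 / L] on the right is expanded by Durfee rectangles,

      [1 / L = sum_n q^(n^2 + k n) / ((q)_n (q)_(n+k))]   with [k = 2l+1],

    and then the two sides agree term by term up to a difference
    [g (n+1) - g n] with [g 0 = 0] and [g n -> 0] ([ext_term_recurrence],
    [telescoper_lim]).  This [g], [telescoper] below, is a rational function of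
    [q^n] and [q^l] times the summand, so that checking the identity is a
    computation with rational functions.

    The induction starts at [l = 0], where [T_0 = 0].  The summand of [S_l] has
    the factor [(1 - q^l) / (1 - q^(n+l))], which is [0 / 0] at [l = n = 0];
    written as [1 - q^l (1 - q^n) / (1 - q^(n+l))] it takes the value [1] there,
    and [S_0 = 1] ([ext_term], [is_series_ext_term]).  Summability of the series
    for [l + 1] comes out of the recurrence, with no separate estimate.

    The Durfee expansion holds for every [k] because its partial sums have an
    exact form ([durfee_sum]),

      [sum_(n<=N) q^(n^2+kn) / ((q)_n (q)_(n+k))
         = 1 / (q)_(N+k) * sum_(i<=N) q^((N+k+1) i) / (q)_i],

    whose last factor tends to [1], only its term [i = 0] surviving.  All the
    estimates use one constant bounding both [(q)_n] and [1 / (q)_n]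
    ([qpoch_bounds]), which also gives the convergence of [(q)_n] to a nonzero
    limit ([qpoch_lim]). *)

(** * Complex sequences and series *)

(** The equality is typed at [C], not at the carrier of the monoid in which the
    sum is formed, so that [ring] and [field] recognise it. *)
Lemma Csum_O (a : nat -> C) : (sum_n a 0 : C) = a O.
Proof. exact (sum_O a). Qed.

Lemma Csum_S (a : nat -> C) (n : nat) : (sum_n a (S n) : C) = sum_n a n + a (S n).
Proof. exact (sum_Sn a n). Qed.

(** Reduces complex limits to real ones, where squeezing is available. *)
Lemma filterlim_Cmod (u : nat -> C) (z : C) :
  filterlim u eventually (locally z) <->
  is_lim_seq (fun n => Cmod (u n - z)) 0.
Proof.
  rewrite (filterlim_locally_ball_norm (U := C_NormedModule) u z).
  rewrite <- is_lim_seq_spec.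
  split; intros H eps; destruct (H eps) as [N HN]; exists N; intros n Hn;
    specialize (HN n Hn).
  - rewrite Rminus_0_r, Rabs_pos_eq by apply Cmod_ge_0. exact HN.
  - rewrite Rminus_0_r, Rabs_pos_eq in HN by apply Cmod_ge_0. exact HN.
Qed.

Lemma is_lim_seq_geom_scal (K r : R) :
  (0 <= r < 1)%R -> is_lim_seq (fun n => (K * r ^ n)%R) 0.
Proof.
  intros Hr.
  replace (Finite 0) with (Rbar_mult K 0) by (simpl; f_equal; ring).
  apply is_lim_seq_scal_l, is_lim_seq_geom.
  rewrite Rabs_pos_eq; lra.
Qed.

(** Every limit below is reached at a geometric rate, up to a sequence whose
    limit is known. *)
Lemma filterlim_geom_close (u v : nat -> C) (z : C) (K r : R) :
  (0 <= r < 1)%R -> filterlim v eventually (locally z) ->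
  (forall n, (Cmod (u n - v n) <= K * r ^ n)%R) ->
  filterlim u eventually (locally z).
Proof.
  intros Hr Hv Huv. apply filterlim_Cmod. apply filterlim_Cmod in Hv.
  apply is_lim_seq_le_le with
    (u := fun _ => 0%R) (w := fun n => (K * r ^ n + Cmod (v n - z))%R).
  - intros n. split; [apply Cmod_ge_0|].
    replace (u n - z) with ((u n - v n) + (v n - z)) by ring.
    eapply Rle_trans; [apply Cmod_triangle|].
    apply Rplus_le_compat_r, Huv.
  - apply is_lim_seq_const.
  - replace (Finite 0) with (Rbar_plus 0 0) by (simpl; f_equal; ring).
    apply is_lim_seq_plus'; [now apply is_lim_seq_geom_scal|exact Hv].
Qed.

Lemma filterlim_Cconst (z : C) : filterlim (fun _ : nat => z) eventually (locally z).
Proof. apply filterlim_const. Qed.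

Lemma filterlim_Cshift (u : nat -> C) (z : C) :
  filterlim (fun n => u (S n)) eventually (locally z) <->
  filterlim u eventually (locally z).
Proof.
  rewrite !filterlim_Cmod.
  symmetry. apply (is_lim_seq_incr_1 (fun n => Cmod (u n - z))).
Qed.

Lemma filterlim_Cshift_n (u : nat -> C) (z : C) (k : nat) :
  filterlim u eventually (locally z) ->
  filterlim (fun n => u (n + k)%nat) eventually (locally z).
Proof.
  intros H. apply filterlim_Cmod. apply filterlim_Cmod in H.
  now apply (is_lim_seq_incr_n (fun n => Cmod (u n - z)) k).
Qed.

Lemma sum_n_telescope (g : nat -> C) (n : nat) :
  (sum_n (fun i => g (S i) - g i) n : C) = g (S n) - g O.
Proof.
  induction n as [|n IH].
  - now rewrite Csum_O.
  - rewrite Csum_S, IH. ring.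
Qed.

Lemma is_series_telescope (g : nat -> C) (z : C) :
  filterlim g eventually (locally z) ->
  is_series (fun i => g (S i) - g i) (z - g O).
Proof.
  intros H. apply filterlim_Cshift in H. apply filterlim_Cmod in H.
  apply (filterlim_Cmod (sum_n (fun i => g (S i) - g i))).
  eapply is_lim_seq_ext; [|exact H].
  intros n. cbv beta. rewrite sum_n_telescope. f_equal. ring.
Qed.

(** The increments form an absolutely convergent series and telescope. *)
Lemma ex_lim_geom_increments (u : nat -> C) (K r : R) :
  (0 <= r < 1)%R -> (forall n, (Cmod (u (S n) - u n) <= K * r ^ n)%R) ->
  exists z : C, filterlim u eventually (locally z).
Proof.
  intros Hr H.
  destruct (ex_series_le (V := C_CompleteNormedModule)
              (fun n => u (S n) - u n) (fun n => (K * r ^ n)%R)) as [s Hs].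
  - exact H.
  - exists (K * / (1 - r))%R.
    apply (is_series_scal K (fun n => (r ^ n)%R)).
    apply is_series_geom. rewrite Rabs_pos_eq; lra.
  - exists (s + u O). apply filterlim_Cshift, filterlim_Cmod.
    apply (proj1 (filterlim_Cmod _ _)) in Hs.
    eapply is_lim_seq_ext; [|exact Hs].
    intros n. cbv beta. rewrite sum_n_telescope. f_equal. ring.
Qed.

(** * The q-Pochhammer symbol and its limit *)

Lemma qpoch_S (q : C) (n : nat) :
  qpoch q q (S n) = qpoch q q n * (1 - q ^ S n).
Proof. reflexivity. Qed.

Lemma pow_le_base (r : R) (n : nat) :
  (0 <= r < 1)%R -> (1 <= n)%nat -> (r ^ n <= r)%R.
Proof.
  intros Hr Hn. destruct n as [|n]; [lia|]. simpl.
  assert (H := pow_incr r 1 n ltac:(lra)). rewrite pow1 in H. nra.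
Qed.

Lemma pow_le_exp (r : R) (m n : nat) :
  (0 <= r < 1)%R -> (m <= n)%nat -> (r ^ n <= r ^ m)%R.
Proof.
  intros Hr Hn. replace n with (m + (n - m))%nat by lia. rewrite pow_add.
  assert (H := pow_incr r 1 (n - m) ltac:(lra)). rewrite pow1 in H.
  assert (H' := pow_le r m ltac:(lra)). nra.
Qed.

Lemma Cmod_one_minus_pow (q : C) (n : nat) :
  (Cmod q < 1)%R -> (1 <= n)%nat -> (1 - Cmod q <= Cmod (1 - q ^ n))%R.
Proof.
  intros Hq Hn.
  assert (H := Cmod_triangle (1 - q ^ n) (q ^ n)).
  replace (1 - q ^ n + q ^ n) with (RtoC 1) in H by ring.
  rewrite Cmod_1, Cmod_pow in H.
  assert (H' := pow_le_base (Cmod q) n (conj (Cmod_ge_0 q) Hq) Hn). lra.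
Qed.

Lemma one_minus_pow_neq0 (q : C) (n : nat) :
  (Cmod q < 1)%R -> (1 <= n)%nat -> 1 - q ^ n <> 0.
Proof.
  intros Hq Hn. apply Cmod_gt_0.
  assert (H := Cmod_one_minus_pow q n Hq Hn). lra.
Qed.

Lemma qpoch_neq0 (q : C) (n : nat) : (Cmod q < 1)%R -> qpoch q q n <> 0.
Proof.
  intros Hq. induction n as [|n IH].
  - apply C1_nz.
  - rewrite qpoch_S. apply Cmult_neq_0; [exact IH|].
    apply one_minus_pow_neq0; [exact Hq|lia].
Qed.

Lemma Cmod_one_minus_le2 (z : C) : (Cmod z <= 1)%R -> (Cmod (1 - z) <= 2)%R.
Proof.
  intros H. eapply Rle_trans; [apply Cmod_triangle|].
  rewrite Cmod_opp, Cmod_1. lra.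
Qed.

(** With [r = Cmod q] and [c = 1 / (1 - r)], each factor [1 - q^(n+1)] and its
    inverse have modulus at most [1 + c r^n <= exp (c r^n)], and the exponents sum to
    [c (1 - r^n) c], hence stay below [c^2]. *)
Lemma qpoch_bounds (q : C) :
  (Cmod q < 1)%R ->
  exists M : R, (0 <= M)%R /\
    forall n, (Cmod (qpoch q q n) <= M)%R /\ (Cmod (/ qpoch q q n) <= M)%R.
Proof.
  intros Hq. set (r := Cmod q) in *.
  assert (Hr : (0 <= r < 1)%R) by (split; [apply Cmod_ge_0|exact Hq]).
  set (c := (/ (1 - r))%R).
  assert (Hc : (c * (1 - r) = 1)%R) by (unfold c; field; lra).
  assert (Hc1 : (1 <= c)%R) by nra.
  assert (Hs : forall n, (Cmod (qpoch q q n) <= exp (c * (c * (1 - r ^ n))))%R /\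
                (Cmod (/ qpoch q q n) <= exp (c * (c * (1 - r ^ n))))%R).
  { induction n as [|n [IH1 IH2]].
    - simpl. rewrite Rminus_diag, !Rmult_0_r, exp_0.
      replace (/ RtoC 1) with (RtoC 1) by (field; apply C1_nz).
      rewrite Cmod_1. lra.
    - assert (Hrn := pow_le r n ltac:(lra)).
      assert (Hrn1 := pow_le_base r (S n) Hr ltac:(lia)).
      assert (He : exp (c * (c * (1 - r ^ S n)))
                   = (exp (c * (c * (1 - r ^ n))) * exp (c * r ^ n))%R).
      { rewrite <- exp_plus. f_equal. simpl.
        transitivity (c * (c * (1 - r ^ n)) + c * (c * (1 - r)) * r ^ n)%R.
        - ring.
        - rewrite Hc. ring. }
      assert (Hx := exp_ineq1_le (c * r ^ n)).
      assert (HSn : (r ^ S n = r * r ^ n)%R) by reflexivity.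
      rewrite He, qpoch_S.
      assert (Hnz := one_minus_pow_neq0 q (S n) Hq ltac:(lia)).
      replace (/ (qpoch q q n * (1 - q ^ S n)))
        with (/ qpoch q q n * / (1 - q ^ S n))
        by (field; split; [exact Hnz|now apply qpoch_neq0]).
      rewrite !Cmod_mult.
      split; apply Rmult_le_compat; try apply Cmod_ge_0; try assumption.
      + eapply Rle_trans; [apply Cmod_triangle|].
        rewrite Cmod_opp, Cmod_1, Cmod_pow. fold r. nra.
      + rewrite Cmod_inv by exact Hnz.
        apply Rle_trans with (/ (1 - r ^ S n))%R.
        * apply Rinv_le_contravar; [lra|].
          assert (H := Cmod_triangle (1 - q ^ S n) (q ^ S n)).
          replace (1 - q ^ S n + q ^ S n) with (RtoC 1) in H by ring.
          rewrite Cmod_1, Cmod_pow in H. fold r in H. lra.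
        * apply Rle_trans with (1 + c * r ^ n)%R; [|exact Hx].
          apply Rmult_le_reg_r with (1 - r ^ S n)%R; [lra|].
          rewrite Rinv_l by lra. rewrite HSn in *.
          assert (Hcr : (c * r ^ n * (1 - r * r ^ n) >= r ^ n)%R).
          { assert (0 <= c * r ^ n)%R by nra.
            assert (c * r ^ n * (1 - r) = r ^ n)%R
              by (transitivity (c * (1 - r) * r ^ n)%R; [ring|rewrite Hc; ring]).
            nra. }
          nra. }
  exists (exp (c * c)). split; [apply Rlt_le, exp_pos|].
  intros n. destruct (Hs n) as [H1 H2].
  assert (Hle : (exp (c * (c * (1 - r ^ n))) <= exp (c * c))%R).
  { assert (Hrn := pow_le r n ltac:(lra)).
    destruct (Req_dec (c * (c * (1 - r ^ n))) (c * c)) as [->|Hne]; [lra|].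
    apply Rlt_le, exp_increasing. nra. }
  lra.
Qed.

(** Both [(q)_n] and [1 / (q)_n] converge since their increments are
    [O(r^n)]; the product of the limits is [1], so neither vanishes. *)
Lemma qpoch_lim (q : C) :
  (Cmod q < 1)%R ->
  exists L : C, L <> 0 /\
    filterlim (qpoch q q) eventually (locally L) /\
    filterlim (fun n => / qpoch q q n) eventually (locally (/ L)).
Proof.
  intros Hq. destruct (qpoch_bounds q Hq) as [M [HM HB]].
  assert (Hr : (0 <= Cmod q < 1)%R) by (split; [apply Cmod_ge_0|exact Hq]).
  destruct (ex_lim_geom_increments (qpoch q q) M (Cmod q) Hr) as [L HL].
  { intros n. rewrite qpoch_S.
    replace (qpoch q q n * (1 - q ^ S n) - qpoch q q n)
      with (- (qpoch q q n * q ^ S n)) by ring.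
    rewrite Cmod_opp, Cmod_mult, Cmod_pow.
    apply Rmult_le_compat; try apply Cmod_ge_0; try apply pow_le; try lra.
    - apply HB.
    - apply pow_le_exp; [exact Hr|lia]. }
  destruct (ex_lim_geom_increments (fun n => / qpoch q q n) M (Cmod q) Hr)
    as [L' HL'].
  { intros n.
    replace (/ qpoch q q (S n) - / qpoch q q n)
      with (/ qpoch q q (S n) * q ^ S n).
    - rewrite Cmod_mult, Cmod_pow.
      apply Rmult_le_compat; try apply Cmod_ge_0; try apply pow_le; try lra.
      + apply HB.
      + apply pow_le_exp; [exact Hr|lia].
    - rewrite qpoch_S. field. split.
      + now apply qpoch_neq0.
      + apply one_minus_pow_neq0; [exact Hq|lia]. }
  assert (HLL : L * L' = 1).
  { (* [L L' - 1] is constant in [n] and bounded by a sequence tending to 0. *)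
    apply Ceq_minus.
    apply Cmod_eq_0. apply Rle_antisym; [|apply Cmod_ge_0].
    assert (HL1 := proj1 (filterlim_Cmod _ _) HL).
    assert (HL2 := proj1 (filterlim_Cmod _ _) HL').
    cbv beta in HL2.
    refine (is_lim_seq_le (fun _ => Cmod (L * L' - 1))
      (fun n => (Cmod L' * Cmod (qpoch q q n - L)
                 + M * Cmod (/ qpoch q q n - L'))%R) (Finite _) (Finite 0) _ _ _).
    - intros n.
      replace (L * L' - 1) with
        (- (L' * (qpoch q q n - L) + qpoch q q n * (/ qpoch q q n - L')))
        by (field; now apply qpoch_neq0).
      rewrite Cmod_opp. eapply Rle_trans; [apply Cmod_triangle|].
      rewrite !Cmod_mult. apply Rplus_le_compat_l.
      apply Rmult_le_compat_r; [apply Cmod_ge_0|apply HB].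
    - apply is_lim_seq_const.
    - replace (Finite 0) with (Finite (Cmod L' * 0 + M * 0)) by (f_equal; ring).
      apply is_lim_seq_plus'.
      + exact (is_lim_seq_scal_l _ (Cmod L') _ HL1).
      + exact (is_lim_seq_scal_l _ M _ HL2). }
  assert (HL0 : L <> 0).
  { intros H0. rewrite H0, Cmult_0_l in HLL. now apply C1_nz. }
  exists L. split; [exact HL0|]. split; [exact HL|].
  replace (/ L) with L'; [exact HL'|].
  transitivity (/ L * (L * L')); [now field|]. rewrite HLL. ring.
Qed.

(** * The Durfee rectangle expansion *)

Definition durfee_term (q : C) (k n : nat) : C :=
  q ^ (n ^ 2 + k * n) / (qpoch q q n * qpoch q q (n + k)).

(** The sum over all [n] does not depend on [k]: replacing [k] by [k + 1]
    changes the summand by a difference, and the boundary term at [N] is the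
    correction on the left. *)
Lemma durfee_sum_shift (q : C) (k N : nat) :
  (Cmod q < 1)%R ->
  sum_n (durfee_term q k) N
  + q ^ (S N ^ 2 + k * S N) / (qpoch q q N * qpoch q q (S N + k))
  = sum_n (durfee_term q (S k)) N.
Proof.
  intros Hq.
  assert (Hp := fun n => qpoch_neq0 q n Hq).
  assert (H1 := fun n => one_minus_pow_neq0 q (S n) Hq ltac:(lia)).
  induction N as [|N IH].
  - rewrite !Csum_O. unfold durfee_term.
    replace (1 ^ 2 + k * 1)%nat with (S k) by (simpl; lia).
    replace (0 ^ 2 + k * 0)%nat with 0%nat by (simpl; lia).
    replace (0 ^ 2 + S k * 0)%nat with 0%nat by (simpl; lia).
    cbn [Nat.add]. rewrite qpoch_S.
    specialize (Hp k). specialize (H1 k). cbn [qpoch Cpow].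
    field. repeat split; try apply C1_nz; assumption.
  - rewrite !Csum_S, <- IH. unfold durfee_term.
    replace (S N + S k)%nat with (S (S N + k)) by lia.
    replace (S (S N) + k)%nat with (S (S N + k)) by lia.
    rewrite (qpoch_S q (S N + k)), (qpoch_S q N).
    replace (S (S N) ^ 2 + k * S (S N))%nat
      with ((S N ^ 2 + k * S N) + (S (S N + k) + S N))%nat by (rewrite !Nat.pow_2_r; lia).
    replace (S N ^ 2 + S k * S N)%nat
      with ((S N ^ 2 + k * S N) + S N)%nat by (rewrite !Nat.pow_2_r; lia).
    rewrite !(Cpow_add_r q (S N ^ 2 + k * S N)), (Cpow_add_r q (S (S N + k))).
    generalize (H1 N) (H1 (S N + k)%nat) (Hp N) (Hp (S N + k)%nat).
    generalize (q ^ S N) (q ^ S (S N + k)) (q ^ (S N ^ 2 + k * S N))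
      (qpoch q q N) (qpoch q q (S N + k)) (sum_n (durfee_term q k) N : C).
    intros x y w P Q E Hx Hy HP HQ. field. repeat split; assumption.
Qed.

(** By [durfee_sum_shift], the sum up to [N + 1] at [k] is the sum up to [N] at
    [k + 1] with two boundary terms, so [N + k] is constant along the induction.
    The boundary terms, with denominators [(q)_N] and [(q)_(N+1)], combine to the
    term [i = N + 1] on the right since [1 - (1 - q^(N+1)) = q^(N+1)]. *)
Lemma durfee_sum (q : C) (N k : nat) :
  (Cmod q < 1)%R ->
  (sum_n (durfee_term q k) N : C)
  = / qpoch q q (N + k)
    * sum_n (fun i => q ^ ((N + k + 1) * i) / qpoch q q i) N.
Proof.
  intros Hq.
  assert (Hp := fun n => qpoch_neq0 q n Hq).
  assert (H1 := fun n => one_minus_pow_neq0 q (S n) Hq ltac:(lia)).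
  revert k. induction N as [|N IH]; intros k.
  - rewrite !Csum_O. unfold durfee_term.
    replace (0 ^ 2 + k * 0)%nat with 0%nat by (simpl; lia).
    replace ((0 + k + 1) * 0)%nat with 0%nat by (simpl; lia).
    cbn [Nat.add qpoch Cpow]. field. apply Hp.
  - rewrite !Csum_S.
    replace (S N + k)%nat with (N + S k)%nat by lia.
    transitivity (sum_n (durfee_term q (S k)) N
      + q ^ ((N + S k + 1) * S N) / (qpoch q q (S N) * qpoch q q (N + S k))).
    + rewrite <- (durfee_sum_shift q k N Hq).
      generalize (sum_n (durfee_term q k) N : C). intros E.
      unfold durfee_term.
      replace (S N + k)%nat with (N + S k)%nat by lia.
      replace ((N + S k + 1) * S N)%nat
        with ((S N ^ 2 + k * S N) + S N)%nat by (rewrite !Nat.pow_2_r; lia).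
      rewrite (Cpow_add_r q (S N ^ 2 + k * S N)), qpoch_S.
      generalize (H1 N) (Hp (N + S k)%nat) (Hp N).
      generalize (q ^ S N) (q ^ (S N ^ 2 + k * S N)) (qpoch q q N)
        (qpoch q q (N + S k)).
      intros x w P Q Hx HQ HP. field. repeat split; assumption.
    + rewrite IH. generalize (Hp (N + S k)%nat) (Hp (S N)).
      intros HQ HP. field. split; assumption.
Qed.

(** The term [i = 0] is [1], and [m i >= m + i - 1] makes the others a geometric
    tail starting at [r^m]. *)
Lemma sum_q_exponential_bound (q : C) (M : R) (m N : nat) :
  (Cmod q < 1)%R -> (forall n, Cmod (/ qpoch q q n) <= M)%R ->
  (1 <= m)%nat ->
  (Cmod (sum_n (fun i => (q ^ (m * i) / qpoch q q i)%C) N - 1)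
   <= M * Cmod q ^ m * ((1 - Cmod q ^ N) / (1 - Cmod q)))%R.
Proof.
  intros Hq HM Hm. set (r := Cmod q) in *.
  assert (Hr : (0 <= r < 1)%R) by (split; [apply Cmod_ge_0|exact Hq]).
  induction N as [|N IH].
  - rewrite Csum_O, Nat.mul_0_r. cbn [qpoch Cpow].
    replace (1 / 1 - 1) with (RtoC 0) by (field; apply C1_nz).
    rewrite Cmod_0. simpl. right. field. lra.
  - rewrite Csum_S.
    set (E := sum_n _ N : C) in *.
    replace (E + q ^ (m * S N) / qpoch q q (S N) - 1)
      with ((E - 1) + / qpoch q q (S N) * q ^ (m * S N))
      by (field; now apply qpoch_neq0).
    eapply Rle_trans; [apply Cmod_triangle|].
    rewrite Cmod_mult, Cmod_pow. fold r.
    replace (M * r ^ m * ((1 - r ^ S N) / (1 - r)))%R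
      with (M * r ^ m * ((1 - r ^ N) / (1 - r)) + M * (r ^ (m + N)))%R
      by (rewrite pow_add; simpl; field; lra).
    apply Rplus_le_compat; [exact IH|].
    apply Rmult_le_compat; try apply Cmod_ge_0; [apply pow_le; lra|apply HM|].
    apply pow_le_exp; [exact Hr|nia].
Qed.

(** In [durfee_sum] the remaining sum differs from [1] by [O(r^(N+k+1))]. *)
Lemma is_series_durfee (q L : C) (k : nat) :
  (Cmod q < 1)%R ->
  filterlim (fun n => / qpoch q q n) eventually (locally (/ L)) ->
  is_series (durfee_term q k) (/ L).
Proof.
  intros Hq HL. destruct (qpoch_bounds q Hq) as [M [HM HB]].
  assert (Hr : (0 <= Cmod q < 1)%R) by (split; [apply Cmod_ge_0|exact Hq]).
  refine (filterlim_geom_close (sum_n (durfee_term q k))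
    (fun n => / qpoch q q (n + k)) (/ L) (M * (M / (1 - Cmod q))) (Cmod q)
    Hr _ _).
  - exact (filterlim_Cshift_n (fun n => / qpoch q q n) (/ L) k HL).
  - intros N. rewrite durfee_sum by exact Hq.
    set (E := sum_n _ N : C).
    replace (/ qpoch q q (N + k) * E - / qpoch q q (N + k))
      with (/ qpoch q q (N + k) * (E - 1)) by ring.
    rewrite Cmod_mult, Rmult_assoc.
    apply Rmult_le_compat; try apply Cmod_ge_0; [apply HB|].
    eapply Rle_trans;
      [apply (sum_q_exponential_bound q M); [exact Hq|apply HB|lia]|].
    set (r := Cmod q) in *.
    assert (HrN := pow_le r N ltac:(lra)).
    assert (Hle := pow_le_exp r N (N + k + 1) Hr ltac:(lia)).
    assert (Hc : (0 < / (1 - r))%R) by (apply Rinv_0_lt_compat; lra).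
    unfold Rdiv. rewrite 2!Rmult_assoc. apply Rmult_le_compat_l; [exact HM|].
    rewrite (Rmult_comm (/ (1 - r))).
    apply Rmult_le_compat; [apply pow_le; lra| |exact Hle|].
    + apply Rmult_le_pos; [|lra].
      assert (H := pow_incr r 1 N ltac:(lra)). rewrite pow1 in H. lra.
    + nra.
Qed.

(** * The recurrence in [l] *)

Lemma series_exp_S_r (l n : nat) :
  series_exp l (S n) = (series_exp l n + (2 * n + 2 * l + 2))%nat.
Proof. unfold series_exp. simpl. lia. Qed.

Lemma series_exp_S_l (l n : nat) :
  series_exp (S l) n = (series_exp l n + (2 * n + 3 * l + 2))%nat.
Proof.
  assert (H1 := series_exp_exact l n). assert (H2 := series_exp_exact (S l) n).
  simpl in H1, H2. nia.
Qed.

Lemma series_exp_split (l n : nat) :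
  series_exp l n = (series_exp l 0 + (n ^ 2 + (2 * l + 1) * n))%nat.
Proof. unfold series_exp. simpl. lia. Qed.

(** The summand [series_term] with [(1 - q^l) / (1 - q^(n+l))] rewritten so that
    it has the right value at [l = n = 0]: since a division by zero is multiplied
    by the numerator [1 - q^0 = 0], the bracket is [1]. *)
Definition ext_term (l : nat) (q : C) (n : nat) : C :=
  q ^ series_exp l n * (1 - q ^ l * (1 - q ^ n) / (1 - q ^ (n + l)))
  / (qpoch q q n * qpoch q q (n + 2 * l)).

Lemma ext_term_series_term (l : nat) (q : C) (n : nat) :
  (Cmod q < 1)%R -> (1 <= l)%nat -> ext_term l q n = series_term l q n.
Proof.
  intros Hq Hl. unfold ext_term, series_term.
  generalize (one_minus_pow_neq0 q (n + l) Hq ltac:(lia)).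
  rewrite Cpow_add_r. intros H.
  field. repeat split; try apply qpoch_neq0; assumption.
Qed.

(** Found from the ansatz [r * (1 - q^n)] times the common factor of the
    summands: comparing coefficients in [x = q^n] forces
    [r = q^l (1 - q^(l+1))].  The factor [1 - q^n] makes it vanish at [n = 0]. *)
Definition telescoper (l : nat) (q : C) (n : nat) : C :=
  q ^ l * (1 - q ^ S l) * (1 - q ^ n) * q ^ series_exp l n
  * (/ qpoch q q n * / qpoch q q (n + (2 * l + 1)) * / (1 - q ^ (n + l))).

Lemma telescoper_0 (l : nat) (q : C) : telescoper l q 0 = 0.
Proof. unfold telescoper. simpl. ring. Qed.

(** After division by [q ^ series_exp l n / ((q)_n (q)_(n+2l))] this is an
    identity between rational functions of [q], [x = q^n] and [a = q^l]. *)
Lemma ext_term_recurrence (l : nat) (q : C) (n : nat) :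
  (Cmod q < 1)%R ->
  ext_term l q n + ext_term (S l) q n
  = q ^ series_exp l 0 * (1 - q ^ (2 * l + 1)) * durfee_term q (2 * l + 1) n
    + (telescoper l q (S n) - telescoper l q n).
Proof.
  intros Hq.
  assert (Hp := fun n => qpoch_neq0 q n Hq).
  assert (H1 := fun n => one_minus_pow_neq0 q (S n) Hq ltac:(lia)).
  assert (HD : q ^ series_exp l 0 * (1 - q ^ (2 * l + 1))
                * durfee_term q (2 * l + 1) n
               = (1 - q ^ (2 * l + 1)) * q ^ series_exp l n
                 / (qpoch q q n * qpoch q q (n + (2 * l + 1)))).
  { unfold durfee_term. rewrite (series_exp_split l n), (Cpow_add_r q (series_exp l 0)).
    field. split; apply Hp. }
  rewrite HD. clear HD. unfold ext_term, telescoper.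
  rewrite series_exp_S_r, series_exp_S_l.
  replace (n + (2 * l + 1))%nat with (S (n + 2 * l)) by lia.
  replace (S n + (2 * l + 1))%nat with (S (S (n + 2 * l))) by lia.
  replace (n + 2 * S l)%nat with (S (S (n + 2 * l))) by lia.
  replace (S n + l)%nat with (S (n + l)) by lia.
  replace (n + S l)%nat with (S (n + l)) by lia.
  rewrite !(qpoch_S q (S (n + 2 * l))), !(qpoch_S q (n + 2 * l)), !(qpoch_S q n).
  generalize (Hp n) (Hp (n + 2 * l)%nat) (H1 n) (H1 (n + 2 * l)%nat)
    (H1 (S (n + 2 * l))) (H1 (n + l)%nat).
  destruct n as [|n].
  - (* [1 - q ^ (n + l)] is zero when [l = 0], so its inverse is kept as an
       opaque factor; it only occurs multiplied by [1 - q ^ 0 = 0]. *)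
    cbn [qpoch Nat.add Nat.mul].
    replace (q ^ l * (1 - q ^ 0) / (1 - q ^ l)) with (RtoC 0)
      by (simpl; unfold Cdiv; ring).
    replace (1 - q ^ 0) with (RtoC 0) by (simpl; ring).
    generalize (/ (1 - q ^ l)). intros z.
    rewrite ?Nat.add_0_r, !Cpow_S, !Cpow_add_r, ?Cpow_S.
    generalize (q ^ l) (q ^ series_exp l 0) (qpoch q q (l + l)).
    cbn [Cpow]. intros a w Q _ HQ Hx Hy1 Hy2 Hz.
    rewrite Cmult_1_r in Hx. field. repeat split; try assumption; apply C1_nz.
  - generalize (H1 (n + l)%nat). replace (S (n + l)) with (S n + l)%nat by lia.
    generalize (S n). clear n. intros n.
    cbn [Nat.mul].
    rewrite ?Nat.add_0_r, !Cpow_S, !Cpow_add_r, ?Cpow_S.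
    generalize (q ^ n) (q ^ l) (q ^ series_exp l n) (qpoch q q n)
      (qpoch q q (n + (l + l))).
    cbn [Cpow]. intros x a w P Q Hxa HP HQ Hx Hy1 Hy2 Hz.
    field. repeat split; assumption.
Qed.

Lemma telescoper_lim (l : nat) (q : C) :
  (Cmod q < 1)%R ->
  filterlim (telescoper l q) eventually (locally (RtoC 0)).
Proof.
  intros Hq. destruct (qpoch_bounds q Hq) as [M [HM HB]].
  assert (Hr : (0 <= Cmod q < 1)%R) by (split; [apply Cmod_ge_0|exact Hq]).
  assert (Hc : (0 < / (1 - Cmod q))%R) by (apply Rinv_0_lt_compat; lra).
  apply (filterlim_geom_close (telescoper l q) (fun _ => RtoC 0) 0
    (1 * 2 * 2 * (M * M * / (1 - Cmod q))) (Cmod q) Hr (filterlim_Cconst 0)).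
  intros n. replace (telescoper l q n - 0) with (telescoper l q n) by ring.
  destruct n as [|n].
  - rewrite telescoper_0, Cmod_0. simpl. nra.
  - assert (Hpow : forall m, (Cmod (q ^ m) <= 1)%R).
    { intros m. rewrite Cmod_pow. exact (pow_le_exp _ 0 m Hr ltac:(lia)). }
    unfold telescoper. rewrite !Cmod_mult.
    rewrite (Rmult_assoc (1 * 2 * 2)), (Rmult_comm (M * M * _)),
      <- (Rmult_assoc (1 * 2 * 2)).
    repeat (apply Rmult_le_compat; repeat apply Rmult_le_pos; try apply Cmod_ge_0).
    + apply Hpow.
    + apply Cmod_one_minus_le2, Hpow.
    + apply Cmod_one_minus_le2, Hpow.
    + rewrite Cmod_pow. apply pow_le_exp; [exact Hr|]. unfold series_exp. nia.
    + apply HB.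
    + apply HB.
    + assert (H := Cmod_one_minus_pow q (S n + l) Hq ltac:(lia)).
      rewrite Cmod_inv by (apply one_minus_pow_neq0; [exact Hq|lia]).
      apply Rinv_le_contravar; lra.
Qed.

(** * The truncated pentagonal sum *)

Definition pent_sum (l : nat) (q : C) : C :=
  Zsum (- Z.of_nat l) (Z.of_nat l - 1) (fun j => Zsign j * q ^ Zpent j).

Lemma Zsum_grow (l : nat) (f : Z -> C) :
  Zsum (- Z.of_nat (S l)) (Z.of_nat (S l) - 1) f
  = f (- Z.of_nat (S l))%Z + Zsum (- Z.of_nat l) (Z.of_nat l - 1) f
    + f (Z.of_nat l).
Proof.
  unfold Zsum.
  replace (Z.to_nat (Z.of_nat (S l) - 1 - - Z.of_nat (S l) + 1))
    with (S (S (2 * l))) by lia.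
  replace (Z.to_nat (Z.of_nat l - 1 - - Z.of_nat l + 1)) with (2 * l)%nat by lia.
  rewrite sum_n_Sm, sum_Sn_m by lia. rewrite <- sum_n_m_S.
  change (@plus C_AbelianMonoid) with Cplus.
  f_equal; [f_equal|].
  - f_equal. lia.
  - apply sum_n_m_ext. intros k. f_equal. lia.
  - f_equal. lia.
Qed.

(** The new indices are [j = l] and [j = -(l+1)], whose exponents are
    [l(3l+1)/2] and [l(3l+1)/2 + 2l + 1]. *)
Lemma pent_sum_S (l : nat) (q : C) :
  pent_sum (S l) q
  = pent_sum l q
    + (- (1)) ^ l * (q ^ series_exp l 0 * (1 - q ^ (2 * l + 1))).
Proof.
  unfold pent_sum. rewrite Zsum_grow.
  assert (H1 := Zpent_exact (- Z.of_nat (S l))).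
  assert (H2 := Zpent_exact (Z.of_nat l)).
  assert (H0 := series_exp_exact l 0). simpl in H0.
  replace (Zpent (- Z.of_nat (S l))) with (series_exp l 0 + (2 * l + 1))%nat
    by nia.
  replace (Zpent (Z.of_nat l)) with (series_exp l 0) by nia.
  unfold Zsign.
  replace (Z.abs_nat (- Z.of_nat (S l))) with (S l) by lia.
  replace (Z.abs_nat (Z.of_nat l)) with l by lia.
  rewrite (Cpow_add_r q (series_exp l 0)), (Cpow_S _ l). ring.
Qed.

(** * Induction on [l] *)

Lemma Csign_sqr (l : nat) : (- (1)) ^ l * (- (1)) ^ l = RtoC 1.
Proof.
  induction l as [|l IH].
  - cbn [Cpow]. ring.
  - rewrite Cpow_S. etransitivity; [|exact IH]. ring.
Qed.

(** At [l = 0] the bracket in [ext_term] is [1 - (1 - q^n) / (1 - q^n)], with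
    [0 / 0 = 0], so only the term [n = 0] is left. *)
Lemma ext_term_0 (q : C) (n : nat) :
  (Cmod q < 1)%R -> ext_term 0 q n = match n with O => 1 | S _ => 0 end.
Proof.
  intros Hq. unfold ext_term. destruct n as [|n].
  - change (series_exp 0 0) with O. cbn [Cpow qpoch Nat.add Nat.mul].
    replace (1 * (1 - 1) / (1 - 1)) with (RtoC 0) by (unfold Cdiv; ring).
    field.
  - rewrite !Nat.add_0_r.
    assert (H := one_minus_pow_neq0 q (S n) Hq ltac:(lia)).
    replace (q ^ 0 * (1 - q ^ S n) / (1 - q ^ S n)) with (RtoC 1)
      by (cbn [Cpow] in *; field; exact H).
    unfold Cdiv. ring.
Qed.

Lemma is_series_ext_term (l : nat) (q L : C) :
  (Cmod q < 1)%R -> L <> 0 ->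
  filterlim (fun n => / qpoch q q n) eventually (locally (/ L)) ->
  is_series (ext_term l q) ((- (1)) ^ l * (1 - pent_sum l q / L)).
Proof.
  intros Hq HL0 HL. induction l as [|l IH].
  - replace ((- (1)) ^ 0 * (1 - pent_sum 0 q / L)) with (RtoC 1)
      by (change (pent_sum 0 q) with (RtoC 0); cbn [Cpow]; field; exact HL0).
    assert (HN : forall N, (sum_n (ext_term 0 q) N : C) = 1).
    { induction N as [|N IHN].
      - rewrite Csum_O. now rewrite ext_term_0.
      - rewrite Csum_S, IHN, ext_term_0 by exact Hq. ring. }
    apply (filterlim_ext (fun _ : nat => RtoC 1)); [|apply filterlim_Cconst].
    intros N. exact (eq_sym (HN N)).
  - assert (HD := is_series_durfee q L (2 * l + 1) Hq HL).
    assert (HT := is_series_telescope _ _ (telescoper_lim l q Hq)).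
    assert (H := is_series_minus _ _ _ _ (is_series_plus _ _ _ _
      (is_series_scal (q ^ series_exp l 0 * (1 - q ^ (2 * l + 1))) _ _ HD) HT) IH).
    rewrite telescoper_0 in H.
    eapply is_series_ext.
    2:{ replace ((- (1)) ^ S l * (1 - pent_sum (S l) q / L)) with
        (q ^ series_exp l 0 * (1 - q ^ (2 * l + 1)) * / L + (0 - 0)
          - (- (1)) ^ l * (1 - pent_sum l q / L)); [exact H|].
      rewrite pent_sum_S, Cpow_S.
      replace (q ^ series_exp l 0 * (1 - q ^ (2 * l + 1)) * / L) with
       ((- (1)) ^ l * (- (1)) ^ l * (q ^ series_exp l 0 * (1 - q ^ (2 * l + 1))) / L)
       by (rewrite Csign_sqr; field; exact HL0).
      field. exact HL0. }
    intros n. cbv beta.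
    (* The goal is stated with the module operations; unfold them to those of [C]. *)
    change (q ^ series_exp l 0 * (1 - q ^ (2 * l + 1)) * durfee_term q (2 * l + 1) n
      + (telescoper l q (S n) - telescoper l q n) - ext_term l q n = ext_term (S l) q n).
    rewrite <- ext_term_recurrence by exact Hq. ring.
Qed.

Theorem theorem1p3 (l : nat) (q : C) (hl : (1 <= l)%nat) (hq : (Cmod q < 1)%R) :
  ex_qpoch_inf q q /\ qpoch_inf q q <> 0 /\
  ex_series (series_term l q) /\
  1 / qpoch_inf q q
    * Zsum (- Z.of_nat l) (Z.of_nat l - 1) (fun j => Zsign j * q ^ Zpent j)
  = 1 + (- (1)) ^ (l - 1) * CSeries (series_term l q).
Proof.
  destruct (qpoch_lim q hq) as [L [HL0 [HL HLi]]].
  assert (Hq : qpoch_inf q q = L) by exact (Clim_unique _ _ HL).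
  assert (HS : is_series (series_term l q)
                 ((- (1)) ^ l * (1 - pent_sum l q / L))).
  { eapply is_series_ext; [|exact (is_series_ext_term l q L hq HL0 HLi)].
    intros n. now apply ext_term_series_term. }
  rewrite Hq. split; [exists L; exact HL|]. split; [exact HL0|].
  split; [eexists; exact HS|].
  rewrite (CSeries_unique _ _ HS).
  fold (pent_sum l q).
  destruct l as [|l]; [lia|].
  replace (S l - 1)%nat with l by lia.
  replace ((- (1)) ^ l * ((- (1)) ^ S l * (1 - pent_sum (S l) q / L)))
    with (- ((- (1)) ^ l * (- (1)) ^ l) * (1 - pent_sum (S l) q / L))
    by (rewrite Cpow_S; ring).
  rewrite Csign_sqr. field. exact HL0.
Qed.
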